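(* Let $0<\rho<\sigma<1$, $0\le\delta<1$, and let $G_1,\dots,G_m:\mathbb{R}^n\to\mathcal{I}(\mathbb{R})$ be $gH$-continuously differentiable interval-valued maps. Let $(x^k),(d^k),(t_k),(\beta_k)$ be infinite sequences generated by the nonlinear conjugate gradient scheme described in the context, let $L_0=\{x\in\mathbb{R}^n: G_i(x)\preceq G_i(x^0)\text{ for all }i=1,\dots,m\}$, and for $k\ge1$ let $$\beta_k^{FR}:=\frac{\psi\circ\phi_{x^k}(v(x^k))}{\psi\circ\phi_{x^{k-1}}(v(x^{k-1}))}.$$ Assume that for each $i=1,\dots,m$, $\nabla_{gH}G_i$ is $gH$-Lipschitz continuous on $L_0$ with some constant $L_i$. (i) Suppose that for every sequence $(y^k)$ in $L_0$ with $G_i(y^{k+1})\preceq G_i(y^k)$ for all $k$ and all $i=1,\dots,m$, there exist $\mathcal{G}_1,\dots,\mathcal{G}_m\in\mathcal{I}(\mathbb{R})$ such that $\mathcal{G}_i\preceq G_i(y^k)$ for all $k$ and all $i$. If $|\beta_k|\le\delta\beta_k^{FR}$ for all $k\ge1$, $d^k$ satisfies the sufficient descent condition (i.e. there is $c>0$ with $\psi\circ\phi_{x^k}(d^k)\le c\,\psi\circ\phi_{x^k}(v(x^k))$ for all $k\ge0$), and $t_k$ satisfies the standard Wolfe conditions for all $k$, then $\liminf_{k\to\infty}\|v(x^k)\|=0$. (ii) Suppose that $L_0$ is bounded. If $0\le\beta_k\le\delta\beta_k^{FR}$ for all $k\ge1$, $d^k$ is a descent direction for all $G_i$ at $x^k$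 (i.e. $\psi\circ\phi_{x^k}(d^k)<0$) for all $k$, and $t_k$ satisfies the strong Wolfe conditions for all $k$, then $\liminf_{k\to\infty}\|v(x^k)\|=0$.
   Context: $\|\cdot\|$ is the Euclidean norm. $\mathcal{I}(\mathbb{R})$ is the set of closed bounded intervals of $\mathbb{R}$. For $A=[a_1,a_2]$, $B=[b_1,b_2]$ in $\mathcal{I}(\mathbb{R})$ and $\alpha\in\mathbb{R}$: $A\oplus B=[a_1+b_1,a_2+b_2]$; $\alpha\odot A=A\odot\alpha=[\min\{\alpha a_1,\alpha a_2\},\max\{\alpha a_1,\alpha a_2\}]$; $A\preceq B$ means $a_1\le b_1$ and $a_2\le b_2$. Write $G_i=[\underline{G}_i,\overline{G}_i]$ with real-valued endpoint functions $\underline{G}_i\le\overline{G}_i$. ''$gH$-continuously differentiable'' means that the endpoint functions are differentiable and the $gH$-gradient $\nabla_{gH}G_i(x)$ is continuous in $x$, where $\nabla_{gH}G_i(x)$ is the vector of intervals whose $j$-th component is $[\underline{\nabla_{gH}G_i}(x)_j,\overline{\nabla_{gH}G_i}(x)_j]$ with $$\underline{\nabla_{gH}G_i}(x)_j=\min\{\partial_j\underline{G}_i(x),\partial_j\overline{G}_i(x)\},\qquad \overline{\nabla_{gH}G_i}(x)_j=\max\{\partial_j\underline{G}_i(x),\partial_j\overline{G}_i(x)\};$$ continuity means that the maps $\underline{\nabla_{gH}G_i},\overline{\nabla_{gH}G_i}:\mathbb{R}^n\to\mathbb{R}^n$ are continuous, and $gH$-Lipschitz continuity of $\nabla_{gH}G_i$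 on $L_0$ with constant $L_i$ means that both of these maps are Lipschitz on $L_0$ with constant $L_i$ (Euclidean norm). For $x,v\in\mathbb{R}^n$, with $|v|=(|v_1|,\dots,|v_n|)^\top$, $$\psi\circ\phi_x(v):=\max_{1\le i\le m}\Big[\tfrac12\big(\underline{\nabla_{gH}G_i}(x)+\overline{\nabla_{gH}G_i}(x)\big)^\top v+\tfrac12\big(\overline{\nabla_{gH}G_i}(x)-\underline{\nabla_{gH}G_i}(x)\big)^\top|v|\Big].$$ For $x\in\mathbb{R}^n$, $v(x)$ is the unique minimizer and $\xi(x)$ the minimum value of the strongly convex function $v\mapsto\psi\circ\phi_x(v)+\tfrac12\|v\|^2$ over $\mathbb{R}^n$. Nonlinear conjugate gradient scheme: given $x^0\in\mathbb{R}^n$ and real parameters $\beta_k$ ($k\ge1$), $d^0=v(x^0)$, $d^k=v(x^k)+\beta_kd^{k-1}$ for $k\ge1$, and $x^{k+1}=x^k+t_kd^k$ with step lengths $t_k>0$. It is assumed throughout that the scheme produces infinite sequences with $\xi(x^k)\ne0$ and $v(x^k)\neq0$ for all $k$ (no stopping). Standard Wolfe conditions for $t_k$: $G_i(x^k+t_kd^k)\preceq G_i(x^k)\oplus[\rho t_k,\rho t_k]\odot\psi\circ\phi_{x^k}(d^k)$ for $i=1,\dots,m$, and $\psi\circ\phi_{x^k+t_kd^k}(d^k)\ge\sigma\,\psi\circ\phi_{x^k}(d^k)$. Strong Wolfe conditions for $t_k$: the same first condition, and $|\psi\circ\phi_{x^k+t_kd^k}(d^k)|\le\sigma\,|\psi\circ\phi_{x^k}(d^k)|$.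 *)

(* Defs.v *)
From HB Require Import structures.
From mathcomp Require Import all_boot all_order all_algebra.
From mathcomp Require Import all_classical all_reals all_analysis.

Set Implicit Arguments.
Unset Strict Implicit.
Unset Printing Implicit Defensive.

Import Order.TTheory GRing.Theory Num.Theory.
Import numFieldNormedType.Exports.

Local Open Scope classical_set_scope.
Local Open Scope ring_scope.

(* Vectors of R^n are row vectors 'rV[R]_n.  The library norm on 'rV[R]_n is
   the sup norm; it induces the usual topology, differentiability and bounded
   sets, but it is not the Euclidean norm, hence [enorm] below. *)

Section Euclidean.
Context {R : realType} {n : nat}.

Definition dotv (u v : 'rV[R]_n) : R := \sum_(j < n) u 0 j * v 0 j.

Definition enorm (v : 'rV[R]_n) : R := Num.sqrt (dotv v v).

Definition absv (v : 'rV[R]_n) : 'rV[R]_n := \row_j `|v 0 j|.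

Definition elipschitz_on (A : set 'rV[R]_n) (L : R)
    (F : 'rV[R]_n -> 'rV[R]_n) : Prop :=
  forall x y, A x -> A y -> enorm (F x - F y) <= L * enorm (x - y).

End Euclidean.

Record cbInterval (R : realType) := CBInterval {
  lower : R;
  upper : R;
  lower_le_upper : lower <= upper }.

Section IntervalArithmetic.
Context {R : realType}.
Implicit Types (A B : cbInterval R) (a : R).

Fact iadd_subproof A B : lower A + lower B <= upper A + upper B.
Proof. by rewrite lerD// lower_le_upper. Qed.

Definition iadd A B : cbInterval R := CBInterval (iadd_subproof A B).

Fact minmax_le (a b : R) : Num.min a b <= Num.max a b.
Proof. by rewrite ge_min !le_max lexx. Qed.

Definition iscale a A : cbInterval R :=
  CBInterval (minmax_le (a * lower A) (a * upper A)).

Definition ipoint a : cbInterval R := CBInterval (lexx a).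

Definition ile A B : Prop := lower A <= lower B /\ upper A <= upper B.

End IntervalArithmetic.

Section GH.
Context {R : realType} {n : nat}.
Implicit Types (G : 'rV[R]_n -> cbInterval R) (x : 'rV[R]_n).

Definition partial (f : 'rV[R]_n -> R) (j : 'I_n) x : R :=
  'D_(delta_mx 0 j) f x.

(* Meaningful when the endpoint functions are differentiable at x. *)
Definition gHgrad G x (j : 'I_n) : cbInterval R :=
  CBInterval (minmax_le (partial (fun z => lower (G z)) j x)
                        (partial (fun z => upper (G z)) j x)).

Definition gHgrad_lower G x : 'rV[R]_n := \row_j lower (gHgrad G x j).

Definition gHgrad_upper G x : 'rV[R]_n := \row_j upper (gHgrad G x j).

Definition gH_continuously_differentiable G : Prop :=
  [/\ forall x, differentiable (fun z => lower (G z)) x,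
      forall x, differentiable (fun z => upper (G z)) x,
      continuous (gHgrad_lower G)
    & continuous (gHgrad_upper G)].

Definition gHgrad_lipschitz_on (A : set 'rV[R]_n) (L : R) G : Prop :=
  elipschitz_on A L (gHgrad_lower G) /\ elipschitz_on A L (gHgrad_upper G).

End GH.

(* The objectives are indexed by 'I_m.+1: there are m.+1 >= 1 of them. *)
Section ConjugateGradient.
Context {R : realType} {n m : nat}.
Variable G : 'I_m.+1 -> 'rV[R]_n -> cbInterval R.
Implicit Types (x v d : 'rV[R]_n) (t rho sigma : R).

Definition psi_phi_term (i : 'I_m.+1) x v : R :=
  2^-1 * dotv (gHgrad_lower (G i) x + gHgrad_upper (G i) x) v
  + 2^-1 * dotv (gHgrad_upper (G i) x - gHgrad_lower (G i) x) (absv v).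

(* The neutral element of the big max is one of its terms, so this is the
   maximum of the finite nonempty family. *)
Definition psi_phi x v : R :=
  \big[Num.max/psi_phi_term ord0 x v]_(i < m.+1) psi_phi_term i x v.

Definition subproblem x v : R := psi_phi x v + 2^-1 * enorm v ^+ 2.

(* The strongly convex subproblem has exactly one minimizer, so the default
   value 0 of [xget] is never used and the choice made by [xget] is forced. *)
Definition vdir x : 'rV[R]_n :=
  xget 0 [set v | forall w, subproblem x v <= subproblem x w].

Definition xi x : R := subproblem x (vdir x).

Definition level_set (x0 : 'rV[R]_n) : set 'rV[R]_n :=
  [set x | forall i, ile (G i x) (G i x0)].

(* [beta 0] is not used. *)
Definition ncg_scheme (x d : nat -> 'rV[R]_n) (t beta : nat -> R) : Prop :=
  [/\ d 0%N = vdir (x 0%N),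
      forall k, d k.+1 = vdir (x k.+1) + beta k.+1 *: d k,
      forall k, x k.+1 = x k + t k *: d k,
      forall k, 0 < t k
    & forall k, xi (x k) != 0 /\ vdir (x k) != 0].

(* For k >= 1; at k = 0 it is the junk value obtained from 0.-1 = 0. *)
Definition beta_FR (x : nat -> 'rV[R]_n) (k : nat) : R :=
  psi_phi (x k) (vdir (x k)) / psi_phi (x k.-1) (vdir (x k.-1)).

Definition wolfe_decrease rho x d t : Prop :=
  forall i, ile (G i (x + t *: d))
    (iadd (G i x) (iscale (psi_phi x d) (ipoint (rho * t)))).

Definition standard_wolfe rho sigma x d t : Prop :=
  wolfe_decrease rho x d t /\
  sigma * psi_phi x d <= psi_phi (x + t *: d) d.

Definition strong_wolfe rho sigma x d t : Prop :=
  wolfe_decrease rho x d t /\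
  `|psi_phi (x + t *: d) d| <= sigma * `|psi_phi x d|.

Definition monotone_sequences_bounded_below (A : set 'rV[R]_n) : Prop :=
  forall y : nat -> 'rV[R]_n,
    (forall k, A (y k)) ->
    (forall k i, ile (G i (y k.+1)) (G i (y k))) ->
    exists B : 'I_m.+1 -> cbInterval R, forall k i, ile (B i) (G i (y k)).

Definition sufficient_descent (x d : nat -> 'rV[R]_n) : Prop :=
  exists2 c : R, 0 < c &
    forall k, psi_phi (x k) (d k) <= c * psi_phi (x k) (vdir (x k)).

End ConjugateGradient.

(* Main.v *)
Require Import Defs.
From HB Require Import structures.
From mathcomp Require Import all_boot all_order all_algebra.
From mathcomp Require Import all_classical all_reals all_analysis.
From mathcomp Require Import ring lra.
Import Order.TTheory GRing.Theory Num.Theory.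
Import numFieldNormedType.Exports.
Local Open Scope classical_set_scope.
Local Open Scope ring_scope.

(** For fixed [y], the function [psi_phi G y] is sublinear, and it is Lipschitz
    in [y] on the level set, so it plays the role that the linear form
    [v |-> dotv (gradient at y) v] plays in the classical convergence theory of
    the Fletcher-Reeves method. Homogeneity along the ray through the minimizer
    gives [psi_phi G y (vdir G y) = - enorm (vdir G y) ^+ 2] ([psi_phi_vdir]);
    existence of the minimizer comes for free, since [vdir] defaults to 0 and
    is nonzero along the iterates.

    Write [f k] for [psi_phi G (x k) (d k)] and [V k] for
    [enorm (vdir G (x k))]. The Wolfe conditions keep the iterates in the level
    set and lower each lower endpoint by a multiple of [(f k / enorm (d k)) ^+ 2]
    ([wolfe_progress]), so [f k / enorm (d k)] tends to 0 as soon as one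
    such endpoint is bounded below ([zoutendijk]).

    Suppose now that [V k] is eventually at least [e > 0]. As the Fletcher-Reeves
    parameter is [V k.+1 ^+ 2 / V k ^+ 2] and [delta < 1], the quotients
    [enorm (d k) / V k ^+ 2] obey a contractive recursion and stay bounded
    ([direction_growth]), so that [r k = - f k / V k ^+ 2] tends to 0 as well
    ([descent_ratio_cvg0]). This is absurd in both cases. Under sufficient
    descent, [r k] is at least [c]. Under the strong Wolfe conditions,
    subadditivity only bounds [psi_phi G (x k.+1) (d k.+1)] from above, which
    leaves [r k.+1 >= 1 - delta * sigma * r k]; but then [r k.+1 + r k >= 1],
    and two consecutive terms cannot both be small. *)

(** * Euclidean geometry of row vectors *)

Section Euclidean.
Context {R : realType} {n : nat}.
Implicit Types (u v w : 'rV[R]_n) (a : R).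

Lemma dotvC u v : dotv u v = dotv v u.
Proof. by apply: eq_bigr => j _; rewrite mulrC. Qed.

Lemma dotvDl u v w : dotv (u + v) w = dotv u w + dotv v w.
Proof. by rewrite -big_split; apply: eq_bigr => j _; rewrite mxE mulrDl. Qed.

Lemma dotvZl a u v : dotv (a *: u) v = a * dotv u v.
Proof. by rewrite /dotv mulr_sumr; apply: eq_bigr => j _; rewrite mxE mulrA. Qed.

Lemma dotvNl u v : dotv (- u) v = - dotv u v.
Proof. by rewrite -scaleN1r dotvZl mulN1r. Qed.

Lemma dotvDr u v w : dotv u (v + w) = dotv u v + dotv u w.
Proof. by rewrite dotvC dotvDl !(dotvC _ u). Qed.

Lemma dotvZr a u v : dotv u (a *: v) = a * dotv u v.
Proof. by rewrite dotvC dotvZl dotvC. Qed.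

Lemma dotvv_ge0 v : 0 <= dotv v v.
Proof. by apply: sumr_ge0 => j _; rewrite -expr2 sqr_ge0. Qed.

Lemma dotvv_eq0 v : (dotv v v == 0) = (v == 0).
Proof.
apply/eqP/eqP => [v0|->]; last by apply: big1 => j _; rewrite mxE mul0r.
apply/rowP => j; rewrite mxE.
have/psumr_eq0P : forall i : 'I_n, true -> 0 <= v 0 i * v 0 i.
  by move=> i _; rewrite -expr2 sqr_ge0.
by move=> /(_ v0 j isT)/eqP; rewrite mulf_eq0 orbb => /eqP.
Qed.

Lemma sqr_enorm v : enorm v ^+ 2 = dotv v v.
Proof. by rewrite sqr_sqrtr// dotvv_ge0. Qed.

Lemma enorm_ge0 v : 0 <= enorm v.
Proof. exact: sqrtr_ge0. Qed.

Lemma enorm_gt0 v : (0 < enorm v) = (v != 0).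
Proof. by rewrite sqrtr_gt0 lt_def dotvv_ge0 andbT dotvv_eq0. Qed.

Lemma enormZ a v : enorm (a *: v) = `|a| * enorm v.
Proof. by rewrite /enorm dotvZl dotvZr mulrA -expr2 sqrtrM ?sqr_ge0// sqrtr_sqr. Qed.

Lemma enormN v : enorm (- v) = enorm v.
Proof. by rewrite -scaleN1r enormZ normrN1 mul1r. Qed.

Lemma enorm_absv v : enorm (absv v) = enorm v.
Proof.
congr Num.sqrt; apply: eq_bigr => j _.
by rewrite mxE -normrM ger0_norm// -expr2 sqr_ge0.
Qed.

(** Expand [0 <= dotv w w] for [w] the component of [u] orthogonal to [v],
    scaled by [dotv v v] to avoid dividing. *)
Lemma cauchy_schwarz u v : dotv u v <= enorm u * enorm v.
Proof.
have [->|v0] := eqVneq v 0.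
  by rewrite dotvC -(scale0r 0) dotvZl mul0r mulr_ge0// enorm_ge0.
have vv : 0 < dotv v v by rewrite -sqr_enorm exprn_gt0// enorm_gt0.
have := dotvv_ge0 (dotv v v *: u + (- dotv u v) *: v).
rewrite !(dotvDl, dotvDr, dotvZl, dotvZr) (dotvC v u).
set q := dotv u v; set s := dotv v v in vv *; set r := dotv u u => H.
have : q ^+ 2 <= r * s by nra.
rewrite -[_ * s](_ : (enorm u * enorm v) ^+ 2 = _); last first.
  by rewrite exprMn !sqr_enorm.
rewrite -[q ^+ 2]real_normK ?num_real// ler_sqr ?nnegrE ?mulr_ge0 ?enorm_ge0//.
by apply: le_trans; exact: ler_norm.
Qed.

Lemma ler_enormD u v : enorm (u + v) <= enorm u + enorm v.
Proof.
rewrite -ler_sqr ?nnegrE ?addr_ge0 ?enorm_ge0// sqr_enorm sqrrD !sqr_enorm.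
rewrite !(dotvDl, dotvDr) (dotvC v u).
by have := cauchy_schwarz u v; lra.
Qed.

(** Since [absv v] is as long as [v], each endpoint difference is paired twice,
    with weight 1/2, with a vector of norm [enorm v]. *)
Lemma midpoint_halfwidth_lipschitz l u l' u' v :
  2^-1 * dotv (l + u) v + 2^-1 * dotv (u - l) (absv v) -
    (2^-1 * dotv (l' + u') v + 2^-1 * dotv (u' - l') (absv v)) <=
  (enorm (l - l') + enorm (u - u')) * enorm v.
Proof.
have := cauchy_schwarz (l - l') v; have := cauchy_schwarz (u - u') v.
have := cauchy_schwarz (u - u') (absv v).
have := cauchy_schwarz (- (l - l')) (absv v).
rewrite enormN enorm_absv !(dotvDl, dotvNl).
move: (enorm v) (absv v) (enorm (l - l')) (enorm (u - u')) => s w a b.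
lra.
Qed.

End Euclidean.

(** * Real sequences *)

Section Sequences.
Context {R : realType}.
Implicit Types (u g z a : nat -> R).

Lemma limn_einf_eq0 u : (forall k, 0 <= u k) ->
  (forall e N, 0 < e -> (forall k, (N <= k)%N -> e <= u k) -> False) ->
  limn_einf (fun k => (u k)%:E) = 0%E.
Proof.
move=> u0 small; rewrite limn_einf_lim.
suff -> : einfs (fun k => (u k)%:E) = cst 0%E by rewrite lim_cst.
apply/funext => N /=; apply/eqP; rewrite eq_le; apply/andP; split; last first.
  by apply: le_ereal_inf_tmp => _ [k _ <-]; rewrite lee_fin.
apply/lee_addgt0Pr => e e0; rewrite add0e.
have [k Nk uk] : exists2 k, (N <= k)%N & u k < e.
  apply: contrapT => /forall2NP H; apply: (small e N e0) => k Nk.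
  by have [|/negP] := H k; [rewrite Nk|rewrite -leNgt].
apply: (@le_trans _ _ (u k)%:E); last by rewrite lee_fin ltW.
by apply: ereal_inf_lbound; exists k.
Qed.

Lemma telescoping_decrease_cvg0 g z B : (forall k, 0 <= z k) ->
  (forall k, g k.+1 + z k <= g k) -> (forall k, B <= g k) ->
  z @ \oo --> (0 : R).
Proof.
move=> z0 dec gB.
have gcvg : cvgn g.
  apply: nonincreasing_is_cvgn; last by exists B => _ [k _ <-].
  apply/nonincreasing_seqP => k; apply: le_trans (dec k).
  by rewrite lerDl.
apply: (@squeeze_cvgr _ _ _ _ (fun=> 0) (fun k => g k - g k.+1)).
- by near=> k; rewrite z0 /= lerBrDl dec.
- exact: cvg_cst.
- by rewrite -(subrr (limn g)); apply: cvgB => //; rewrite cvg_shiftS.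
Unshelve. all: by end_near. Qed.

Lemma contraction_bounded a A delta N : 0 <= delta < 1 -> 0 <= A ->
  0 <= a N -> (forall k, (N <= k)%N -> a k.+1 <= A + delta * a k) ->
  forall k, (N <= k)%N -> a k <= a N + A / (1 - delta).
Proof.
move=> /andP[d0 d1] A0 aN step; set M := A / (1 - delta).
have ME : A = (1 - delta) * M by rewrite mulrC divfK// subr_eq0 gt_eqF.
have M0 : 0 <= M by rewrite divr_ge0// subr_ge0 ltW.
elim=> [|k IH]; first by rewrite leqn0 => /eqP->; rewrite lerDl.
rewrite leq_eqVlt => /predU1P[<-|Nk]; first by rewrite lerDl.
apply: (le_trans (step _ Nk)); have := IH Nk; rewrite ME; nra.
Qed.

End Sequences.

(** The Fletcher-Reeves bound on [b] trades the denominator [V] for [W], so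
    [b * q] costs at most [delta * sigma <= 1] times the previous ratio. Here
    [f] and [g] are the slopes along two consecutive directions, [q] is the
    slope along the old direction at the new point, and [V], [W] are the squared
    norms of the two steepest descent directions. *)
Lemma consecutive_ratio_sum {R : realType} (q b delta sigma f g V W : R) :
  0 < V -> 0 < W -> f <= 0 -> g <= - W + b * q ->
  0 <= b <= delta * (W / V) -> q <= sigma * - f ->
  0 <= delta <= 1 -> 0 <= sigma <= 1 -> 1 <= - g / W + - f / V.
Proof.
move=> V0 W0 f0 gq /andP[b0 bW] qf /andP[d0 d1] /andP[s0 s1].
have r0 : 0 <= - f / V by rewrite divr_ge0 ?oppr_ge0// ltW.
have fE : - f = - f / V * V by rewrite divfK// gt_eqF.
move: (- f / V) r0 fE => r r0 fE; rewrite fE in qf.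
suff bq : b * q <= r * W.
  rewrite -(ler_pM2r W0) mul1r mulrDl divfK ?gt_eqF//; lra.
apply: le_trans (ler_wpM2l b0 qf) _.
have srV : 0 <= sigma * (r * V) by rewrite !mulr_ge0// ltW.
apply: le_trans (ler_wpM2r srV bW) _.
rewrite (_ : _ * (sigma * _) = delta * sigma * (r * W)); last first.
  by field; rewrite gt_eqF.
by rewrite ler_piMl ?mulr_ile1// mulr_ge0// ltW.
Qed.

Lemma continuous_bounded_below_on (R : realType) (n : nat)
    (f : 'rV[R]_n -> R) (A : set 'rV[R]_n) :
  continuous f -> bounded_set A -> exists B, forall y, A y -> B <= f y.
Proof.
move=> fc [M [Mr HM]]; set r := M + 1.
have Kc : compact [set y : 'rV[R]_n | `|y| <= r].
  apply: bounded_closed_compact.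
    exists r; split; first exact: num_real.
    by move=> s rs y /le_trans; apply; exact: ltW.
  have -> : [set y : 'rV[R]_n | `|y| <= r] = Num.norm @^-1` [set s : R | s <= r].
    by [].
  by apply: closed_comp; [move=> y _; exact: norm_continuous|exact: closed_le].
have [N [Nr HN]] := compact_bounded
  (continuous_compact (continuous_subspaceT fc) Kc).
exists (- (N + 1)) => y Ay; have yr : `|y| <= r.
  by apply: (HM r) => //; rewrite /r ltrDl.
have /= := HN (N + 1) _ (f y) (ex_intro2 _ _ y yr erefl).
by rewrite ltrDl ltr01 => /(_ isT); rewrite ler_norml => /andP[].
Qed.

(** * The support function of the interval gradients *)

Section SupportFunction.
Context {R : realType} {n m : nat}.
Variable G : 'I_m.+1 -> 'rV[R]_n -> cbInterval R.
Implicit Types (y z u v w : 'rV[R]_n) (s t L rho sigma : R) (A : set 'rV[R]_n).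

Lemma psi_phi_term_le i y v : psi_phi_term G i y v <= psi_phi G y v.
Proof. exact: le_bigmax. Qed.

Lemma psi_phi_leP y v s :
  (forall i, psi_phi_term G i y v <= s) -> psi_phi G y v <= s.
Proof. by move=> H; apply/bigmax_leP; split. Qed.

(** The half-width of an interval gradient is nonnegative, so the term in
    [absv] inherits the triangle inequality of the absolute value. *)
Lemma psi_phi_term_subadditive i y u v :
  psi_phi_term G i y (u + v) <= psi_phi_term G i y u + psi_phi_term G i y v.
Proof.
rewrite /psi_phi_term dotvDr.
suff : dotv (gHgrad_upper (G i) y - gHgrad_lower (G i) y) (absv (u + v)) <=
    dotv (gHgrad_upper (G i) y - gHgrad_lower (G i) y) (absv u) +
    dotv (gHgrad_upper (G i) y - gHgrad_lower (G i) y) (absv v) by lra.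
rewrite -dotvDr; apply: ler_sum => j _; rewrite !mxE.
by apply: ler_wpM2l; [rewrite subr_ge0 minmax_le|exact: ler_normD].
Qed.

Lemma psi_phi_termZ i y s v :
  0 <= s -> psi_phi_term G i y (s *: v) = s * psi_phi_term G i y v.
Proof.
move=> s0; rewrite /psi_phi_term; have -> : absv (s *: v) = s *: absv v.
  by apply/rowP => j; rewrite !mxE normrM ger0_norm.
by rewrite !dotvZr; ring.
Qed.

Lemma psi_phi_subadditive y u v :
  psi_phi G y (u + v) <= psi_phi G y u + psi_phi G y v.
Proof.
apply: psi_phi_leP => i; apply: le_trans (psi_phi_term_subadditive _ _ _ _) _.
by apply: lerD; exact: psi_phi_term_le.
Qed.

Lemma psi_phi0 y : psi_phi G y 0 = 0.
Proof.
have H i : psi_phi_term G i y 0 = 0.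
  by rewrite -(scale0r 0) psi_phi_termZ// mul0r.
apply/eqP; rewrite eq_le psi_phi_leP => [|i]; last by rewrite H.
by rewrite -[X in X <= _](H ord0) psi_phi_term_le.
Qed.

Lemma psi_phiZ_le y s v : 0 <= s -> psi_phi G y (s *: v) <= s * psi_phi G y v.
Proof.
move=> s0; apply: psi_phi_leP => i; rewrite psi_phi_termZ//.
exact/ler_wpM2l/psi_phi_term_le.
Qed.

(** Each of the two gradient endpoints contributes [L], whence the factor 2. *)
Lemma psi_phi_lipschitz A L y z v :
  (forall i, gHgrad_lipschitz_on A L (G i)) -> A y -> A z ->
  psi_phi G y v - psi_phi G z v <= 2 * L * enorm (y - z) * enorm v.
Proof.
move=> lip Ay Az; rewrite lerBlDl; apply: psi_phi_leP => i.
have [/(_ _ _ Ay Az) lipl /(_ _ _ Ay Az) lipu] := lip i.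
apply: le_trans (lerD (psi_phi_term_le i z v) (lexx _)); rewrite -lerBlDl.
apply: le_trans (midpoint_halfwidth_lipschitz _ _ _ _ v) _.
have -> : 2 * L * enorm (y - z) = L * enorm (y - z) + L * enorm (y - z) by ring.
by apply: ler_wpM2r; [exact: enorm_ge0|exact: (lerD lipl lipu)].
Qed.

(** Along the ray through the minimizer [v], homogeneity turns the objective
    into [s * psi_phi G y v + s ^+ 2 / 2 * enorm v ^+ 2], which is minimal at
    [s = 1]; its derivative vanishes there. *)
Lemma psi_phi_vdir y :
  vdir G y != 0 -> psi_phi G y (vdir G y) = - enorm (vdir G y) ^+ 2.
Proof.
rewrite /vdir; case: xgetP => [v _ vmin v0|]; last by rewrite eqxx.
have N0 : 0 < enorm v ^+ 2 by rewrite exprn_gt0// enorm_gt0.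
have ray s : 0 <= s -> psi_phi G y v + 2^-1 * enorm v ^+ 2 <=
    s * psi_phi G y v + 2^-1 * (s ^+ 2 * enorm v ^+ 2).
  move=> s0; apply: le_trans (vmin (s *: v)) _.
  rewrite /subproblem enormZ exprMn real_normK ?num_real// lerD2r.
  exact: psi_phiZ_le.
set f := psi_phi G y v in ray *; set N := enorm v ^+ 2 in N0 ray *.
have fneg := ray 0 (lexx 0).
(* the quadratic in [s] is minimized at [s = - f / N] *)
have s0 : 0 <= - f / N by rewrite divr_ge0 ?ltW//; lra.
have := ray _ s0.
have fE : f = (f / N) * N by rewrite divfK// gt_eqF.
rewrite mulNr; set c := f / N in fE *; rewrite fE => H.
have : (c + 1) ^+ 2 <= 0.
  rewrite -(pmulr_lle0 _ N0); move: H; nra.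
rewrite le_eqVlt ltNge sqr_ge0 orbF sqrf_eq0 addr_eq0 => /eqP ->.
by rewrite mulN1r.
Qed.

Lemma uniform_lipschitz A :
  (forall i, exists L, gHgrad_lipschitz_on A L (G i)) ->
  exists2 L, 0 < L & forall i, gHgrad_lipschitz_on A L (G i).
Proof.
move=> /choice[F FL]; exists (1 + \sum_i `|F i|).
  by rewrite ltr_wpDr// sumr_ge0.
move=> i; have FS : F i <= 1 + \sum_j `|F j|.
  rewrite (bigD1 i)//= addrCA; apply: le_trans (ler_norm _) _.
  by rewrite lerDl addr_ge0// sumr_ge0.
by have [l u] := FL i; split=> y z Ay Az;
  [apply: le_trans (l y z Ay Az) _|apply: le_trans (u y z Ay Az) _];
  rewrite ler_wpM2r ?enorm_ge0.
Qed.

Lemma strong_wolfe_standard rho sigma y v t : psi_phi G y v < 0 ->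
  strong_wolfe G rho sigma y v t -> standard_wolfe G rho sigma y v t.
Proof.
move=> f0 [dec curv]; split=> //; move: curv f0.
move: (psi_phi G (y + t *: v) v) (psi_phi G y v) => g f curv f0; move: curv.
by rewrite (ltr0_norm f0) ler_norml mulrN opprK => /andP[].
Qed.

Lemma wolfe_decreaseE rho y v t i : wolfe_decrease G rho y v t ->
  lower (G i (y + t *: v)) <= lower (G i y) + psi_phi G y v * (rho * t) /\
  upper (G i (y + t *: v)) <= upper (G i y) + psi_phi G y v * (rho * t).
Proof. by move=> /(_ i)[]; rewrite /= minxx maxxx. Qed.

(** The curvature condition and the Lipschitz bound force the step length to
    be at least [(1 - sigma) * - psi_phi G y v / (2 * L * enorm v ^+ 2)];
    insert this in the decrease condition. *)
Lemma wolfe_progress A L rho sigma y v t i :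
  0 < rho -> sigma < 1 -> 0 < L -> 0 < t ->
  (forall j, gHgrad_lipschitz_on A L (G j)) -> A y -> A (y + t *: v) ->
  psi_phi G y v < 0 -> standard_wolfe G rho sigma y v t ->
  lower (G i (y + t *: v)) +
    rho * (1 - sigma) / (2 * L) * (psi_phi G y v / enorm v) ^+ 2
  <= lower (G i y).
Proof.
move=> rho0 sigma1 L0 t0 lip Ay Az f0 [dec curv].
have v0 : 0 < enorm v.
  by rewrite enorm_gt0; apply: contraTneq f0 => ->; rewrite psi_phi0 ltxx.
have := psi_phi_lipschitz A L _ _ v lip Az Ay.
have -> : y + t *: v - y = t *: v by rewrite addrC addKr.
rewrite enormZ (gtr0_norm t0) => lipf.
have [Gdec _] := wolfe_decreaseE rho y v t i dec.
apply: le_trans (lerD Gdec (lexx _)) _.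
move: f0 curv lipf; set f := psi_phi G y v; set g := psi_phi G _ v => f0 curv lipf.
set q := f / enorm v; have fE : f = q * enorm v by rewrite divfK// gt_eqF.
have q0 : q < 0 by rewrite pmulr_llt0 ?invr_gt0.
rewrite -addrA gerDl.
have -> : rho * (1 - sigma) / (2 * L) * q ^+ 2 =
    rho * - q * ((1 - sigma) * - q / (2 * L)) by ring.
have step : (1 - sigma) * - q / (2 * L) <= t * enorm v.
  rewrite ler_pdivrMr ?mulr_gt0// -(ler_pM2r v0).
  by move: curv lipf; rewrite fE; lra.
have rq : 0 <= rho * - q by rewrite mulr_ge0 ?oppr_ge0// ltW.
by have := ler_wpM2l rq step; rewrite fE; lra.
Qed.

End SupportFunction.

(* Keeps rewriting from unfolding the maxima when comparing them. *)
#[local] Opaque psi_phi_term psi_phi.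

(** * The conjugate gradient iterates *)

Section Iterates.
Context {R : realType} {n m : nat}.
Variable G : 'I_m.+1 -> 'rV[R]_n -> cbInterval R.
Implicit Types (x d : nat -> 'rV[R]_n) (t beta : nat -> R) (rho sigma delta : R).

Lemma iterates_decrease rho x d t : 0 < rho -> (forall k, 0 < t k) ->
  (forall k, x k.+1 = x k + t k *: d k) ->
  (forall k, psi_phi G (x k) (d k) < 0) ->
  (forall k, wolfe_decrease G rho (x k) (d k) (t k)) ->
  forall k i, ile (G i (x k.+1)) (G i (x k)).
Proof.
move=> rho0 t0 xS f0 dec k i.
have [lo up] := wolfe_decreaseE G rho _ _ _ i (dec k).
have step : psi_phi G (x k) (d k) * (rho * t k) <= 0.
  by rewrite nmulr_rle0// mulr_ge0// ltW.
by split; rewrite xS; [apply: le_trans lo _|apply: le_trans up _];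
  rewrite gerDl.
Qed.

Lemma iterates_in_level_set x :
  (forall k i, ile (G i (x k.+1)) (G i (x k))) ->
  forall k, level_set G (x 0%N) (x k).
Proof.
move=> dec; elim=> [i|k IH i]; first by split.
by have [lo up] := dec k i; have [lo0 up0] := IH i; split;
  [exact: le_trans lo lo0|exact: le_trans up up0].
Qed.

(** Zoutendijk's theorem: each step lowers the lower endpoint of any one
    objective by a fixed multiple of the squared quotient, and this endpoint is
    bounded below along the iterates. *)
Lemma zoutendijk rho sigma x d t (A : set 'rV[R]_n) L i B :
  0 < rho -> sigma < 1 -> 0 < L ->
  (forall j, gHgrad_lipschitz_on A L (G j)) -> (forall k, A (x k)) ->
  (forall k, 0 < t k) -> (forall k, x k.+1 = x k + t k *: d k) ->
  (forall k, psi_phi G (x k) (d k) < 0) ->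
  (forall k, standard_wolfe G rho sigma (x k) (d k) (t k)) ->
  (forall k, B <= lower (G i (x k))) ->
  (fun k => psi_phi G (x k) (d k) / enorm (d k)) @ \oo --> (0 : R).
Proof.
move=> rho0 sigma1 L0 lip xA t0 xS f0 wolfe GB.
set C := rho * (1 - sigma) / (2 * L).
pose q k := psi_phi G (x k) (d k) / enorm (d k).
have C0 : 0 < C by rewrite divr_gt0 ?mulr_gt0 ?subr_gt0.
have sq0 : (fun k => C * q k ^+ 2) @ \oo --> (0 : R).
  apply: (telescoping_decrease_cvg0 (fun k => lower (G i (x k))) _ B) => // k.
    by rewrite mulr_ge0 ?sqr_ge0// ltW.
  rewrite xS; apply: (wolfe_progress G A) => //.
  by rewrite -xS.
apply/cvgr0Pnorm_lt => e e0.
have Ce : 0 < C * e ^+ 2 by rewrite mulr_gt0// exprn_gt0.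
move/cvgr0Pnorm_lt : sq0 => /(_ _ Ce); apply: filterS => k /=.
rewrite -/(q k) normrM (gtr0_norm C0) (ltr_pM2l C0) normrX.
by rewrite ltr_sqr ?nnegrE ?normr_ge0 ?(ltW e0).
Qed.

Lemma beta_FR_enorm x k : vdir G (x k) != 0 -> vdir G (x k.+1) != 0 ->
  beta_FR G x k.+1 = enorm (vdir G (x k.+1)) ^+ 2 / enorm (vdir G (x k)) ^+ 2.
Proof. by move=> v0 v1; rewrite /beta_FR /= !psi_phi_vdir// invrN mulrNN. Qed.

(** The quotient [enorm (d k) / enorm (vdir G (x k)) ^+ 2] satisfies the
    contractive recursion [u k.+1 <= 1 / e + delta * u k]: the Fletcher-Reeves
    bound replaces exactly one denominator by the next. *)
Lemma direction_growth delta x d t beta e N : 0 <= delta < 1 ->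
  ncg_scheme G x d t beta ->
  (forall k, (1 <= k)%N -> `|beta k| <= delta * beta_FR G x k) ->
  0 < e -> (forall k, (N <= k)%N -> e <= enorm (vdir G (x k))) ->
  exists2 M, 0 < M &
    forall k, (N <= k)%N -> enorm (d k) <= M * enorm (vdir G (x k)) ^+ 2.
Proof.
move=> delta01 [_ dS _ _ /all_and2[_ v0]] betaFR e0 ev.
have /andP[delta0 delta1] := delta01.
pose V k := enorm (vdir G (x k)).
have V0 k : 0 < V k by rewrite enorm_gt0.
pose u k := enorm (d k) / V k ^+ 2.
have u0 k : 0 <= u k by rewrite divr_ge0 ?sqr_ge0 ?enorm_ge0.
have step k : (N <= k)%N -> u k.+1 <= e^-1 + delta * u k.
  move=> Nk; rewrite /u ler_pdivrMr ?exprn_gt0// dS.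
  apply: le_trans (ler_enormD _ _) _; rewrite enormZ mulrDl lerD//.
    rewrite expr2 mulrA -/(V k.+1) ler_peMl ?(ltW (V0 _))// mulrC.
    by rewrite ler_pdivlMr// mul1r ev// leqW.
  have FR : beta_FR G x k.+1 = V k.+1 ^+ 2 / V k ^+ 2.
    exact: (beta_FR_enorm x k (v0 k) (v0 k.+1)).
  have := betaFR k.+1 isT; rewrite FR => bk.
  apply: le_trans (ler_wpM2r (enorm_ge0 _) bk) _.
  move: (V k.+1 ^+ 2) (V k ^+ 2)^-1 (enorm (d k)) => W r s.
  by rewrite (_ : delta * (W * r) * s = delta * (s * r) * W)//; ring.
have e'0 : 0 <= e^-1 by rewrite invr_ge0 ltW.
have ub := contraction_bounded u e^-1 delta N delta01 e'0 (u0 N) step.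
exists (u N + e^-1 / (1 - delta)).
  by rewrite ltr_wpDl// divr_gt0 ?invr_gt0// subr_gt0.
move=> k Nk; rewrite -ler_pdivrMr; first exact: ub.
by rewrite exprn_gt0// V0.
Qed.

(** If the [vdir G (x k)] stay away from zero, the directions are controlled
    by their squared norms, and Zoutendijk's theorem survives the exchange of
    denominators. *)
Lemma descent_ratio_cvg0 rho sigma delta x d t beta B e N :
  0 < rho -> sigma < 1 -> 0 <= delta < 1 ->
  ncg_scheme G x d t beta ->
  (forall i, exists L, gHgrad_lipschitz_on (level_set G (x 0%N)) L (G i)) ->
  (forall k, (1 <= k)%N -> `|beta k| <= delta * beta_FR G x k) ->
  (forall k, psi_phi G (x k) (d k) < 0) ->
  (forall k, standard_wolfe G rho sigma (x k) (d k) (t k)) ->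
  (forall k, B <= lower (G ord0 (x k))) ->
  0 < e -> (forall k, (N <= k)%N -> e <= enorm (vdir G (x k))) ->
  (fun k => - psi_phi G (x k) (d k) / enorm (vdir G (x k)) ^+ 2) @ \oo
    --> (0 : R).
Proof.
move=> rho0 sigma1 delta01 scheme /uniform_lipschitz[L L0 lip] betaFR f0 wolfe
  GB e0 ev.
have [M M0 dM] := direction_growth delta x d t beta e N delta01 scheme betaFR e0 ev.
have [_ _ xS t0 /all_and2[_ v0]] := scheme.
have dec := iterates_decrease rho x d t rho0 t0 xS f0 (fun k => (wolfe k).1).
have zout := zoutendijk rho sigma x d t _ L ord0 B rho0 sigma1 L0 lip
  (iterates_in_level_set x dec) t0 xS f0 wolfe GB.
have Mzout : (fun k => M * - (psi_phi G (x k) (d k) / enorm (d k))) @ \oo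
    --> (0 : R).
  rewrite -(mulr0 M) -(oppr0 R); apply: cvgMr; exact: cvgN.
apply: (squeeze_cvgr _ (cvg_cst _) Mzout).
near=> k; have Nk : (N <= k)%N by near: k; exact: nbhs_infty_ge.
have V0 : 0 < enorm (vdir G (x k)) ^+ 2 by rewrite exprn_gt0// enorm_gt0.
have D0 : 0 < enorm (d k).
  by rewrite enorm_gt0; apply: contraTneq (f0 k) => ->; rewrite psi_phi0 ltxx.
have nf0 : 0 <= - psi_phi G (x k) (d k) by rewrite oppr_ge0 ltW.
rewrite -mulNr; move: nf0 (dM k Nk) V0 D0.
move: (- psi_phi G (x k) (d k)) (enorm (d k)) (enorm (vdir G (x k)) ^+ 2).
move=> p D V p0 DMV V0 D0; rewrite divr_ge0 ?(ltW V0)//= ler_pdivrMr//.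
rewrite (_ : M * (p / D) * V = p * (M * V) / D); last by ring.
by rewrite ler_pdivlMr//; exact: ler_wpM2l.
Unshelve. all: by end_near. Qed.

End Iterates.

Theorem theorem4p2 (R : realType) (n m : nat)
    (G : 'I_m.+1 -> 'rV[R]_n -> cbInterval R)
    (rho sigma delta : R)
    (x d : nat -> 'rV[R]_n) (t beta : nat -> R)
    (rho_gt0 : 0 < rho) (rho_lt_sigma : rho < sigma) (sigma_lt1 : sigma < 1)
    (delta_ge0 : 0 <= delta) (delta_lt1 : delta < 1)
    (GC1 : forall i, gH_continuously_differentiable (G i))
    (scheme : ncg_scheme G x d t beta)
    (Glip : forall i, exists L : R,
       gHgrad_lipschitz_on (level_set G (x 0%N)) L (G i)) :
  (monotone_sequences_bounded_below G (level_set G (x 0%N)) ->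
   (forall k, (1 <= k)%N -> `|beta k| <= delta * beta_FR G x k) ->
   sufficient_descent G x d ->
   (forall k, standard_wolfe G rho sigma (x k) (d k) (t k)) ->
   limn_einf (fun k => (enorm (vdir G (x k)))%:E) = 0%E)
  /\
  (bounded_set (level_set G (x 0%N)) ->
   (forall k, (1 <= k)%N -> 0 <= beta k <= delta * beta_FR G x k) ->
   (forall k, psi_phi G (x k) (d k) < 0) ->
   (forall k, strong_wolfe G rho sigma (x k) (d k) (t k)) ->
   limn_einf (fun k => (enorm (vdir G (x k)))%:E) = 0%E).
Proof.
have [_ dS xS t0 /all_and2[_ v0]] := scheme.
have delta01 : 0 <= delta < 1 by rewrite delta_ge0.
have V0 k : 0 < enorm (vdir G (x k)) ^+ 2 by rewrite exprn_gt0// enorm_gt0.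
have fV k : psi_phi G (x k) (vdir G (x k)) = - enorm (vdir G (x k)) ^+ 2.
  exact: psi_phi_vdir.
split.
- move=> below betaFR [c c0 descent] wolfe.
  have f0 k : psi_phi G (x k) (d k) < 0.
    by apply: le_lt_trans (descent k) _; rewrite fV mulrN oppr_lt0 mulr_gt0.
  have dec := iterates_decrease G rho x d t rho_gt0 t0 xS f0
    (fun k => (wolfe k).1).
  have [B GB] := below x (iterates_in_level_set G x dec) dec.
  apply: limn_einf_eq0 => [k|e N e0 ev]; first exact: enorm_ge0.
  have /cvgr0Pnorm_lt/(_ c c0)[K _ /(_ K (leqnn K))/=] :=
    descent_ratio_cvg0 G rho sigma delta x d t beta _ e N rho_gt0 sigma_lt1
      delta01 scheme Glip betaFR f0 wolfe (fun k => (GB k ord0).1) e0 ev.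
  apply/negP; rewrite -leNgt; apply: le_trans (ler_norm _).
  by rewrite ler_pdivlMr// lerNr -mulrN -fV.
- move=> bnd betaFR f0 swolfe.
  have wolfe k := strong_wolfe_standard G rho sigma _ _ _ (f0 k) (swolfe k).
  have abs_betaFR k : (1 <= k)%N -> `|beta k| <= delta * beta_FR G x k.
    by move=> /betaFR/andP[b0 bk]; rewrite ger0_norm.
  have dec := iterates_decrease G rho x d t rho_gt0 t0 xS f0
    (fun k => (wolfe k).1).
  have lower_cont : continuous (fun z => lower (G ord0 z)).
    by have [dl _ _ _] := GC1 ord0; move=> z; exact: differentiable_continuous.
  have [B GB] := continuous_bounded_below_on _ _ _ _ lower_cont bnd.
  apply: limn_einf_eq0 => [k|e N e0 ev]; first exact: enorm_ge0.
  pose r k := - psi_phi G (x k) (d k) / enorm (vdir G (x k)) ^+ 2.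
  have r0 k : 0 <= r k by rewrite divr_ge0 ?oppr_ge0 ?ltW.
  have r_sum k : 1 <= r k.+1 + r k.
    apply: (consecutive_ratio_sum (psi_phi G (x k.+1) (d k)) (beta k.+1) delta
      sigma) => //.
    - exact: ltW.
    - rewrite dS; apply: le_trans (psi_phi_subadditive _ _ _ _) _.
      rewrite (fV k.+1) lerD2l; apply: psi_phiZ_le.
      by have /andP[] := betaFR k.+1 isT.
    - by have := betaFR k.+1 isT; rewrite (beta_FR_enorm G x k (v0 k) (v0 k.+1)).
    - have [_] := swolfe k; rewrite -(xS k) => curv.
      apply: le_trans (ler_norm _) _; apply: le_trans curv _.
      by have -> := ltr0_norm (f0 k).
    - by rewrite delta_ge0 ltW.
    - by apply/andP; split; apply: ltW => //; exact: lt_trans rho_lt_sigma.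
  have half : 0 < 2^-1 :> R by rewrite invr_gt0.
  have /cvgr0Pnorm_lt/(_ _ half)[K _ small] :=
    descent_ratio_cvg0 G rho sigma delta x d t beta _ e N rho_gt0 sigma_lt1
      delta01 scheme Glip abs_betaFR f0 wolfe
      (fun k => GB _ (iterates_in_level_set G x dec k)) e0 ev.
  have rK : `|r K| < 2^-1 := small K (leqnn K).
  have rK1 : `|r K.+1| < 2^-1 := small K.+1 (leqnSn K).
  move: rK rK1 (r0 K) (r0 K.+1) (r_sum K); move: (r K) (r K.+1) => a b.
  by move=> aK bK a0 b0; rewrite (ger0_norm a0) (ger0_norm b0) in aK bK; lra.
Qed.
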